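(* Let $G$ be a finite graph, let $R(G)$ be a residual graph of $G$, and let $H=G\setminus V(R(G))$. Then (i) $\gamma_{\rm MB}'(G)=\frac{n(H)}{2}+\gamma_{\rm MB}'(R(G))$; (ii) $\frac{n(H)}{2}+\gamma_{\rm MB}(R(G))-1\le \gamma_{\rm MB}(G)\le \frac{n(H)}{2}+\gamma_{\rm MB}(R(G))$.
   Context: All graphs are finite and simple; $n(X)$ is the number of vertices of $X$. A pendant $P_2$ in a graph is a path $xy$ attached to the rest of the graph by a single edge, i.e. $x$ has degree $1$, its unique neighbor $y$ has degree $2$, and $y$ has exactly one other neighbor; removing it deletes $x$ and $y$. If the current graph is itself $P_2$, it may also be removed, leaving the empty graph. The residual graph $R(G)$ is obtained from $G$ by iteratively removing pendant $P_2$'s until none is present. The Maker-Breaker domination game on a graph: Dominator and Staller alternately select a vertex not selected before; Dominator wins if at some point his selected vertices form a dominating set, Staller wins otherwise. In the D-game Dominator moves first, in the S-game Staller moves first. $\gamma_{\rm MB}(G)$ (resp. $\gamma_{\rm MB}'(G)$) is the minimum $k$ such that Dominator has a strategy in the D-game (resp. S-game) guaranteeing that his selected vertices dominate the graph after at most $k$ of his moves, whatever Staller does, and is $\infty$ if he has no winning strategy. *)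

(* Defs.v *)
From HB Require Import structures.
From mathcomp Require Import all_boot all_order all_algebra.
From mathcomp Require Import boolp constructive_ereal.
Set Implicit Arguments.
Unset Strict Implicit.
Unset Printing Implicit Defensive.

Import GRing.Theory.

Record sgraph := SGraph {
  svertex :> finType;
  sedge : rel svertex;
  sedge_sym : symmetric sedge;
  sedge_irrefl : irreflexive sedge }.

Notation "x -- y" := (sedge x y) (at level 30).

Section Induced.
Variables (G : sgraph) (A : {set G}).

Definition induced_rel : rel {x : G | x \in A} := fun x y => val x -- val y.

Fact induced_sym : symmetric induced_rel.
Proof. by move=> x y; apply: sedge_sym. Qed.

Fact induced_irrefl : irreflexive induced_rel.
Proof. by move=> x; apply: sedge_irrefl. Qed.

Definition induced : sgraph := SGraph induced_sym induced_irrefl.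

End Induced.

Section Residual.
Variable G : sgraph.
Implicit Types (A : {set G}) (x y : G).

(* Every graph met while deleting vertices of G is induced, so it is
   represented by its vertex set A; degrees are taken in G[A]. *)
Definition deg_in A x : nat := #|[set y in A | x -- y]|.

Definition pendant_P2 A x y : bool :=
  [&& x \in A, y \in A, x -- y, deg_in A x == 1 & deg_in A y == 2].

(* G[A] is a single edge xy. *)
Definition is_P2 A x y : bool := (A == [set x; y]) && (x -- y).

(* P2_reduces A means that G[A] arises from G by iterated removals. *)
Inductive P2_reduces : {set G} -> Prop :=
| P2_start : P2_reduces [set: G]
| P2_remove A x y : P2_reduces A -> pendant_P2 A x y || is_P2 A x y ->
    P2_reduces (A :\: [set x; y]).

(* Removing a current graph equal to P_2 is optional: P_2 contains no
   pendant_P2, so both it and the empty graph are residual graphs of P_2. *)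
Definition residual A : Prop :=
  P2_reduces A /\ forall x y, ~~ pendant_P2 A x y.

End Residual.

Inductive player := Dominator | Staller.

Section Game.
Variables (G : sgraph) (first : player).
Implicit Types (p : seq G) (D : {set G}).

Definition dominating D : bool :=
  [forall v, (v \in D) || [exists u in D, u -- v]].

(* A position is the duplicate-free sequence of the vertices selected so far,
   in order of selection; move number i (from 0) is Dominator's iff the
   following holds. *)
Definition dom_turn (i : nat) : bool :=
  if first is Dominator then ~~ odd i else odd i.

Definition dom_selected p : {set G} := [set x in p | dom_turn (index x p)].

(* The option makes room for a strategy on the graph without vertices. *)
Definition strategy := seq G -> option G.

Definition legal (sigma : strategy) : Prop :=
  forall p, uniq p -> size p < #|G| -> dom_turn (size p) ->
  exists2 x, sigma p = Some x & x \notin p.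

(* Plays go on until all vertices are selected; whether and when Dominator
   wins is read off the prefixes. *)
Definition full_play p : Prop := uniq p /\ size p = #|G|.

Definition follows (sigma : strategy) p : Prop :=
  forall i, i < size p -> dom_turn i -> onth p i = sigma (take i p).

Definition dom_wins_within (k : nat) : Prop :=
  exists2 sigma : strategy, legal sigma &
    forall p, full_play p -> follows sigma p ->
    exists j, dominating (dom_selected (take j p)) /\
              #|dom_selected (take j p)| <= k.

End Game.

Definition min_or_oo (P : nat -> Prop) : \bar rat :=
  if pselect (exists k, `[< P k >]) is left exP
  then ((ex_minn exP)%:R)%:E else +oo%E.

Definition gammaMB (G : sgraph) : \bar rat :=
  min_or_oo (dom_wins_within G Dominator).

Definition gammaMB' (G : sgraph) : \bar rat :=
  min_or_oo (dom_wins_within G Staller).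

(* Main.v *)
(** Both games are played on the family of closed neighbourhoods, which
    Dominator must hit. If x is a leaf with support y, Staller forces Dominator
    to answer y by x, which leaves exactly the neighbourhoods of G - {x, y};
    conversely Dominator can treat {x, y} as a pair. This gives (i) and the
    upper bound in (ii).

    For the lower bound in (ii), one move of Dominator may disturb the pendant
    P_2's above it, and the point is that the resulting loss of 1 does not
    accumulate. By induction on the removed pairs, one bounds simultaneously a
    few perturbed games on G: a vertex z already dominated, or a short path of
    new vertices attached at z. If z is outside the next pair {x, y}, Staller
    forces y, x; if z = y, the same exchange makes the perturbation irrelevant;
    and if z = x, the attached path grows by y and x, which Staller shortens
    again by playing a vertex of it that creates two threats. *)

Require Import Defs.
From HB Require Import structures.
From mathcomp Require Import all_boot all_order all_algebra.
From mathcomp Require Import boolp constructive_ereal.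
Set Implicit Arguments.
Unset Strict Implicit.
Unset Printing Implicit Defensive.

Import Order.TTheory GRing.Theory Num.Theory.

(** * The game of hitting a family of sets *)

Section TransversalGame.
Variable T : finType.
Implicit Types (E F : {set T} -> Prop) (e f : {set T}) (u v x y : T).

(** A family lists the sets that Dominator still has to hit, reduced to the vertices that Staller
    has not taken. A set that has become empty means that Dominator has lost. *)
Definition hitD v E : {set T} -> Prop := fun e => E e /\ v \notin e.

Definition hitS v E : {set T} -> Prop := fun e => exists2 f, E f & e = f :\ v.

Definition no_edge E := forall e, ~ E e.

(* A player may select any vertex; one that lies in no edge, such as a vertex
   selected before, acts as a pass. [winS] allows Staller an explicit pass for
   the case where [T] is empty. *)
Fixpoint winD k E : Prop :=
  no_edge E \/
  if k is k'.+1 then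
    exists v, winD k' (hitD v E) /\ forall u, winD k' (hitS u (hitD v E))
  else False.

Definition winS k E := winD k E /\ forall u, winD k (hitS u E).

(** The order by which games are compared: whatever hits all of [E] hits all of [F], so [F] is at
    least as easy for Dominator. *)
Definition covers E F := forall f, F f -> exists2 e, E e & e \subset f.

Lemma sub_covers E F : (forall e, F e -> E e) -> covers E F.
Proof. by move=> sFE f /sFE Ef; exists f. Qed.

Lemma covers_trans F E E' : covers E F -> covers F E' -> covers E E'.
Proof.
move=> EF FE' f /FE'[e1 /EF[e2 Ee2 s21] s1f]; exists e2 => //.
exact: subset_trans s21 s1f.
Qed.

Lemma covers_hitD v E F : covers E F -> covers (hitD v E) (hitD v F).
Proof.
move=> EF f [/EF[e Ee sef] vf]; exists e => //; split=> //.
by apply: contra vf; apply: (subsetP sef).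
Qed.

Lemma covers_hitS v E F : covers E F -> covers (hitS v E) (hitS v F).
Proof.
by move=> EF _ [f /EF[e Ee sef] ->]; exists (e :\ v); [exists e | apply: setSD].
Qed.

Lemma covers_hitDl v E F :
  (forall f, F f -> exists e, [/\ E e, v \notin e & e \subset f]) ->
  covers (hitD v E) F.
Proof. by move=> EF f /EF[e [Ee ve sef]]; exists e. Qed.

Lemma covers_hitSl u E F :
  (forall f, F f -> exists2 e, E e & e \subset u |: f) -> covers (hitS u E) F.
Proof.
move=> EF f /EF[e Ee sef]; exists (e :\ u); first by exists e.
by rewrite subDset.
Qed.

(** The form used after a forced exchange: Staller's [u] may be missing from the sets of [F], and
    the sets of [E] used must avoid Dominator's [v]. *)
Lemma covers_hitDS v u E F :
  (forall f, F f -> exists e, [/\ E e, v \notin e & e \subset u |: f]) ->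
  covers (hitD v (hitS u E)) F.
Proof.
move=> EF; apply: covers_hitDl => f /EF[e [Ee ve sef]]; exists (e :\ u).
by split; [exists e | rewrite !inE negb_and ve orbT | rewrite subDset].
Qed.

Lemma covers_hitS_self u E : covers (hitS u E) E.
Proof. by apply: covers_hitSl => e Ee; exists e => //; apply: subsetUr. Qed.

Lemma covers_self_hitD v E : covers E (hitD v E).
Proof. by apply: sub_covers => e []. Qed.

(** Moves of both players preserve [covers], so Dominator can copy his moves from [E]. *)
Lemma winD_covers k E F : covers E F -> winD k E -> winD k F.
Proof.
elim: k E F => [|k IH] E F EF /= [noE|].
- by left=> f /EF[e /noE].
- by case.
- by left=> f /EF[e /noE].
move=> [v [Dv Sv]]; right; exists v.
have EFv : covers (hitD v E) (hitD v F) by apply: covers_hitD.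
split=> [|u]; first exact: (IH _ _ EFv).
by apply: (IH _ _ _ (Sv u)); apply: covers_hitS.
Qed.

Lemma winS_covers k E F : covers E F -> winS k E -> winS k F.
Proof.
move=> EF [DE SE]; split; first exact: winD_covers DE.
by move=> u; apply: winD_covers (SE u); apply: covers_hitS.
Qed.

Lemma no_edge_winD k E : no_edge E -> winD k E.
Proof. by case: k => [|k]; left. Qed.

Lemma no_edge_winS k E : no_edge E -> winS k E.
Proof.
by move=> noE; split=> [|u]; apply: no_edge_winD => // e [f /noE].
Qed.

Lemma winD_hitD k v E : winS k (hitD v E) -> winD k.+1 E.
Proof. by right; exists v. Qed.

Lemma winD_leq k k' E : k <= k' -> winD k E -> winD k' E.
Proof.
elim: k k' E => [|k IH] [|k'] E //=.
- by move=> _ [] // ; left.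
move=> lek [|[v [Dv Sv]]]; [by left | right; exists v].
by split=> [|u]; apply: IH.
Qed.

Lemma lost_winD k E : E set0 -> ~ winD k E.
Proof.
elim: k E => [|k IH] E E0 /= [noE|]; first by case: (noE _ E0).
- by [].
- by case: (noE _ E0).
by move=> [v [Dv _]]; apply: IH Dv; split; rewrite ?inE.
Qed.

Lemma winS_no_threat k E x e : E e -> e \subset [set x] -> ~ winS k E.
Proof.
move=> Ee sex [_ /(_ x)]; apply: lost_winD; exists e => //.
by apply/esym/eqP; rewrite setD_eq0.
Qed.

(** Vacuous if Dominator cannot win; this is how the value $\infty$ is included in the lower
    bounds. *)
Definition needD n E := forall k, winD k E -> n <= k.
Definition needS n E := forall k, winS k E -> n <= k.

Lemma needD_covers n E F : covers E F -> needD n F -> needD n E.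
Proof. by move=> EF nF k /(winD_covers EF)/nF. Qed.

Lemma needS_covers n E F : covers E F -> needS n F -> needS n E.
Proof. by move=> EF nF k /(winS_covers EF)/nF. Qed.

Lemma needS_leq n n' E : n <= n' -> needS n' E -> needS n E.
Proof. by move=> le_n nE k /nE; apply: leq_trans. Qed.

Lemma needD_leq n n' E : n <= n' -> needD n' E -> needD n E.
Proof. by move=> le_n nE k /nE; apply: leq_trans. Qed.

Lemma needD_needS n E : needD n E -> needS n E.
Proof. by move=> nE k []/nE. Qed.

Lemma needS_play u n E : needD n (hitS u E) -> needS n E.
Proof. by move=> nE k [_ /(_ u)/nE]. Qed.

Lemma needD_reply n E e : E e -> (forall v, needS n (hitD v E)) -> needD n.+1 E.
Proof.
move=> Ee nE [|k] /=; first by case=> // /(_ _ Ee).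
by case=> [/(_ _ Ee)//|[v /nE]].
Qed.

Lemma needS_hitD n v E : needD n E -> needS n.-1 (hitD v E).
Proof. by move=> nE k /winD_hitD/nE; case: n {nE}. Qed.

(** Staller's [y] leaves only [x] to hit [e]. Any other reply loses, which makes the bound vacuous,
    and the reply [x] costs Dominator one move. *)
Lemma needS_force x y n E e :
    E e -> e \subset [set x; y] -> needS n (hitD x (hitS y E)) ->
  needS n.+1 E.
Proof.
move=> Ee sexy nE; apply: (@needS_play y).
have Ee' : hitS y E (e :\ y) by exists e.
have sex : e :\ y \subset [set x] by rewrite subDset setUC.
apply: (needD_reply Ee') => v; case: (eqVneq v x) => [-> //|vx] k wk.
case: (@winS_no_threat k _ x (e :\ y) _ sex wk); split=> //.
by apply: contra vx => /(subsetP sex); rewrite inE.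
Qed.

(** One move cannot meet both threats, so Dominator has lost and every bound [n] holds. *)
Lemma needD_two_threats x y n E e f :
    E e -> e \subset [set x] -> E f -> f \subset [set y] -> x != y ->
  needD n E.
Proof.
move=> Ee sex Ef sfy xy; case: n => // n; apply: (needD_reply Ee) => v k wk.
case: (eqVneq v x) => [vx|vx].
  case: (@winS_no_threat k _ y f _ sfy wk); split=> //.
  by rewrite vx; apply: contra xy => /(subsetP sfy); rewrite inE.
case: (@winS_no_threat k _ x e _ sex wk); split=> //.
by apply: contra vx => /(subsetP sex); rewrite inE.
Qed.

Definition addf e E : {set T} -> Prop := fun f => f = e \/ E f.

(** Dominator follows his strategy for [F] and answers a Staller move in the pair by its other
    vertex, which hits the pair at the price of one move and leaves [F] as it was. *)
Lemma pairing_win k x y F : x != y ->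
    (forall f, F f -> x \notin f /\ y \notin f) ->
  (winD k F -> winD k.+1 (addf [set x; y] F)) /\
  (winS k F -> winS k.+1 (addf [set x; y] F)).
Proof.
move=> xy.
pose avoids F0 := forall f : {set T}, F0 f -> x \notin f /\ y \notin f.
have drop F0 a b : a != b -> (forall f, F0 f -> a \notin f /\ b \notin f) ->
    covers F0 (hitD a (hitS b (addf [set a; b] F0))).
  move=> ab Fab _ [[f [->|Ff] ->]]; first by rewrite !inE eqxx ab.
  case: (Fab _ Ff) => af bf _; exists f => //.
  by apply/subsetP => w wf; rewrite !inE wf andbT; apply: contraNneq bf => <-.
have winS_of_winD j :
    (forall F0, avoids F0 -> winD j F0 -> winD j.+1 (addf [set x; y] F0)) ->
    forall F0, avoids F0 -> winS j F0 -> winS j.+1 (addf [set x; y] F0).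
  move=> IH F0 Fxy [Dj Sj]; split=> [|u]; first exact: IH.
  have [ux|ux] := eqVneq u x.
    apply: (@winD_hitD _ y); rewrite ux setUC; apply: winS_covers (conj Dj Sj).
    by apply: drop => [|f /Fxy[]]; rewrite 1?eq_sym.
  have [uy|uy] := eqVneq u y.
    apply: (@winD_hitD _ x); rewrite uy; apply: winS_covers (conj Dj Sj).
    exact: drop.
  apply: winD_covers (IH _ _ (Sj u)).
    apply: sub_covers => _ [f [->|Ff] ->]; last by right; exists f.
    left; apply/setP => w; rewrite !inE; case: (eqVneq w u) => // ->.
    by rewrite (negPf ux) (negPf uy).
  by move=> _ [f /Fxy[xf yf] ->]; rewrite !inE (negPf xf) (negPf yf) !andbF.
suff winD_pair : forall F0, avoids F0 ->
    winD k F0 -> winD k.+1 (addf [set x; y] F0).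
  by move=> Fxy; split; [exact: winD_pair | exact: winS_of_winD].
(* Once [F0] is exhausted, the one extra move is spent on the pair itself. *)
have no_edge_case j F0 : no_edge F0 -> winD j.+1 (addf [set x; y] F0).
  move=> noF; apply: (@winD_leq 1) => //.
  apply: (@winD_hitD _ x); apply: no_edge_winS.
  by move=> e [[->|/noF//]]; rewrite !inE eqxx.
elim: k {F} => [|k IH] F Fxy; case=> //; try exact: no_edge_case.
case=> v wv; apply: (@winD_hitD _ v).
apply: (@winS_covers _ (addf [set x; y] (hitD v F))).
  by apply: sub_covers => e [[->|Fe] ve]; [left | right].
by apply: winS_of_winD => // f [/Fxy].
Qed.

End TransversalGame.

(** * Invariance of the hitting game under injections of the ground set *)

Section Transfer.
Variables (T T' : finType) (f : T -> T').
Hypothesis f_inj : injective f.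
Implicit Types (E : {set T} -> Prop) (F : {set T'} -> Prop).

Definition imfam E : {set T'} -> Prop := fun e' => exists2 e, E e & e' = f @: e.

Lemma imset_setD1 (e : {set T}) u : f @: (e :\ u) = (f @: e) :\ f u.
Proof.
apply/setP => w.
apply/imsetP/setD1P => [[v /setD1P[vu ve] ->]|[wu /imsetP[v ve wE]]].
  by rewrite (inj_eq f_inj) imset_f.
exists v => //; rewrite !inE ve andbT.
by apply: contraNneq wu => <-; rewrite wE.
Qed.

Lemma imfam_hitD v E F : covers F (imfam E) ->
  covers (hitD (f v) F) (imfam (hitD v E)).
Proof.
move=> FE; apply: (covers_trans (covers_hitD (v := f v) FE)).
by apply: sub_covers => _ [e [Ee ve] ->]; split; [exists e | rewrite mem_imset].
Qed.

Lemma imfam_hitS u E F : covers F (imfam E) ->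
  covers (hitS (f u) F) (imfam (hitS u E)).
Proof.
move=> FE; apply: (covers_trans (covers_hitS (v := f u) FE)).
apply: sub_covers => _ [_ [e Ee ->] ->]; exists (f @: e); first by exists e.
exact: imset_setD1.
Qed.

Lemma winD_of_imfam k E F : covers F (imfam E) -> winD k F -> winD k E.
Proof.
have no E0 F0 : covers F0 (imfam E0) -> no_edge F0 -> no_edge E0.
  by move=> FE noF e Ee; have [|e' /noF] := FE (f @: e); first by exists e.
elim: k E F => [|k IH] E F FE /=; first by case=> // /(no _ _ FE); left.
case=> [/(no _ _ FE)|[v' [Dv Sv]]]; first by left.
case: (pselect (exists v, v' = f v)) => [[v v'E]|v'f]; last first.
  (* A move of Dominator outside the image of [f] hits no image set, so it can be skipped. *)
  apply: (@winD_leq _ k k.+1 E) => //; apply: IH Dv => _ [e Ee ->].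
  have [|e' Fe' se'] := FE (f @: e); first by exists e.
  exists e' => //; split=> //; apply/negP => /(subsetP se')/imsetP[v _ v'E].
  by apply: v'f; exists v.
rewrite {}v'E in Dv Sv; right; exists v.
split; first exact: IH (imfam_hitD FE) Dv.
by move=> u; apply: IH (Sv (f u)); apply/imfam_hitS/imfam_hitD.
Qed.

Lemma winS_of_imfam k E F : covers F (imfam E) -> winS k F -> winS k E.
Proof.
move=> FE [Dk Sk]; split=> [|u]; first exact: winD_of_imfam FE Dk.
exact: winD_of_imfam (imfam_hitS FE) (Sk (f u)).
Qed.

Lemma imfam_winS_of_winD k E F :
    (forall E0 F0, covers (imfam E0) F0 -> winD k E0 -> winD k F0) ->
  covers (imfam E) F -> winS k E -> winS k F.
Proof.
move=> winDk EF [Dk Sk]; split=> [|u']; first exact: winDk EF Dk.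
case: (pselect (exists u, u' = f u)) => [[u ->]|u'f].
  apply: winDk (Sk u) => _ [e' /EF[e1 [e Ee ->] se] ->].
  exists (f @: e :\ f u); last exact: setSD.
  by exists (e :\ u); [exists e | rewrite imset_setD1].
(* A move of Staller outside the image of [f] takes nothing from the image sets; it counts as a
   pass, which [winS] provides for. *)
apply: winDk Dk => _ [e' /EF[e1 [e Ee ->] se] ->].
exists (f @: e); first by exists e.
apply/subsetP => w wf; rewrite !inE (subsetP se _ wf) andbT.
by apply/eqP => wu; apply: u'f; case/imsetP: wf => v' _; exists v'; rewrite -wu.
Qed.

Lemma winD_imfam k E F : covers (imfam E) F -> winD k E -> winD k F.
Proof.
have no E0 F0 : covers (imfam E0) F0 -> no_edge E0 -> no_edge F0.
  by move=> EF noE e' /EF[e1 [e /noE]].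
elim: k E F => [|k IH] E F EF; first by case=> // /(no _ _ EF); left.
case=> [/(no _ _ EF)|[v wv]]; first by left.
apply: (@winD_hitD _ _ (f v)); apply: (imfam_winS_of_winD IH) wv.
move=> e' [/EF[e1 [e Ee ->] se] ve']; exists (f @: e) => //.
exists e => //; split=> //; apply: contra ve' => ve.
by apply: (subsetP se); apply: imset_f.
Qed.

Lemma winS_imfam k E F : covers (imfam E) F -> winS k E -> winS k F.
Proof. by apply: imfam_winS_of_winD => E0 F0; apply: winD_imfam. Qed.

End Transfer.

(** * Removing a pendant pair *)

Section PendantRemoval.
Variable G : sgraph.
Implicit Types (A : {set G}) (a b c u v w x y z : G).

(** The closed neighbourhood of [v] in G[A]: a set dominates G[A] exactly when it hits all of
    these. *)
Definition nbhd A v : {set G} := [set u in A | (u == v) || (v -- u)].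

Definition nbhd_plus A z a v : {set G} :=
  nbhd A v :|: (if v == z then [set a] else set0).

Definition nbhds A : {set G} -> Prop :=
  fun e => exists2 v, v \in A & e = nbhd A v.

(** Here [z] need not be dominated any more, but it may still be selected. *)
Definition nbhds_but A z : {set G} -> Prop :=
  fun e => exists v, [/\ v \in A, v != z & e = nbhd A v].

Definition nbhds_plus A z a : {set G} -> Prop :=
  fun e => exists2 v, v \in A & e = nbhd_plus A z a v.

(* The perturbed games that Dominator's first move can lead to, with n in the
   role of the lower bound for the S-game on G[A]. In lb_plus a new vertex a is
   joined to z but need not be dominated itself; in lb_path2 a path a b is
   attached by the edge bz, in lb_path3 a path a b c by the edge cz, and in both
   a need not be dominated. *)
Record lower_bounds A n : Prop := LowerBounds {
  lb_S : needS n (nbhds A);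
  lb_D : needD n.-1 (nbhds A);
  lb_but z : needS n.-1 (nbhds_but A z);
  lb_plus z a : a \notin A -> needS n (nbhds_plus A z a);
  lb_path2 z a b : a \notin A -> b \notin A -> a != b ->
    needS n (addf [set a; b; z] (nbhds_plus A z b));
  lb_path3 z a b c : a \notin A -> b \notin A -> c \notin A ->
    a != b -> b != c -> a != c -> z != a ->
    needS n.+1 (addf [set a; b; c] (addf [set b; c; z] (nbhds_plus A z c))) }.


Ltac neqs := repeat match goal with
  | H : is_true (?p != ?q) |- context [?p == ?q] => rewrite (negPf H)
  | H : is_true (?p != ?q) |- context [?q == ?p] =>
      rewrite (eq_sym q p) (negPf H)
  end.
Ltac notin_tac := rewrite !inE; neqs; rewrite ?eqxx //=;
  repeat match goal with |- context [?p == ?q] => case: (p == q) => //= end.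
Ltac subset_tac :=
  let w := fresh "w" in
  apply/subsetP => w; rewrite !inE;
  repeat match goal with |- context [w == ?t] => case: (w == t) => //= end.

Arguments lb_but {A n} _ z.
Arguments lb_plus {A n} _ z {a}.
Arguments lb_path2 {A n} _ z {a b}.
Arguments lb_path3 {A n} _ z {a b c}.

Lemma nbhd_notin A v a : a \notin A -> a \notin nbhd A v.
Proof. by move=> aA; rewrite inE (negPf aA). Qed.

Lemma mem_nbhd A v : v \in A -> v \in nbhd A v.
Proof. by move=> vA; rewrite inE vA eqxx. Qed.

Lemma plus_sub A v z a :
  nbhd_plus A z a v \subset a |: nbhd A v.
Proof.
by rewrite /nbhd_plus; case: ifP => _; rewrite ?setU0 ?subsetUr // setUC.
Qed.

Lemma plus_notin A v z a u : u \notin nbhd A v -> u != a ->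
  u \notin nbhd_plus A z a v.
Proof. by move=> uA ua; rewrite inE (negPf uA); case: ifP; rewrite inE. Qed.

Lemma plus_neq A v z a : v != z -> nbhd_plus A z a v = nbhd A v.
Proof. by move=> vz; rewrite /nbhd_plus (negPf vz) setU0. Qed.

Lemma mem_neq A x a : x \in A -> a \notin A -> a != x.
Proof. by move=> xA; apply: contraNneq => ->. Qed.

(** Start of the induction, at the residual graph. A dominated [z] helps no more than having
    selected [z], hence the loss of one; in the other perturbations Staller first takes the new
    vertex next to [z]. *)
Lemma lower_bounds0 A n : needD n (nbhds A) -> lower_bounds A n.
Proof.
move=> nD.
have nS := needD_needS nD.
have nSz z : needS n.-1 (hitD z (nbhds A)) by exact: needS_hitD.
split=> //.
- exact: needD_leq (leq_pred n) nD.
- move=> z; apply: needS_covers (nSz z) => _ [[v vA ->] zv].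
  exists (nbhd A v) => //.
  by exists v; split=> //; apply: contraNneq zv => <-; apply: mem_nbhd.
- move=> z a aA; apply: (@needS_play _ a); apply: needD_covers nD.
  apply: covers_hitSl => _ [v vA ->]; exists (nbhd_plus A z a v).
    by exists v.
  exact: plus_sub.
- move=> z a b aA bA ab; apply: (@needS_play _ b); apply: needD_covers nD.
  apply: covers_hitSl => _ [v vA ->]; exists (nbhd_plus A z b v).
    by right; exists v.
  exact: plus_sub.
move=> z a b c aA bA cA ab bc ac za; set F := addf _ _.
have F1 : hitS c F ([set a; b; c] :\ c) by exists [set a; b; c] => //; left.
have F2 : hitS c F ([set b; c; z] :\ c).
  by exists [set b; c; z] => //; right; left.
have F3 v : v \in A -> F (nbhd_plus A z c v).
  by move=> vA; right; right; exists v.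
(* After Staller's [c] the path edges lie in {a, b} and {b, z}. A reply in {a, b} does nothing in
   G[A]. A reply [z] saves at most one move there, which Staller recovers by [a], forcing [b]. After
   any other reply, Staller's [b] threatens at both [a] and [z]. *)
apply: (@needS_play _ c); apply: (needD_reply F1) => v.
have [vab|/norP[va vb]] := boolP ((v == a) || (v == b)).
  have vA : v \notin A by case/orP: vab => /eqP->.
  have vc : v != c by case/orP: vab => /eqP->.
  apply: needS_covers nS; apply: covers_hitDS => _ [u uA ->].
  exists (nbhd_plus A z c u); split; first exact: F3.
    by apply: plus_notin => //; apply: nbhd_notin.
  exact: plus_sub.
have [vz|vz] := eqVneq v z.
  move: va vb; rewrite {}vz => _ zb.
  apply: needS_leq (leqSpred n) _.
  apply: (@needS_force _ b a _ _ ([set a; b; c] :\ c)).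
  - by split=> //; notin_tac.
  - subset_tac.
  apply: needS_covers (nSz z); apply: covers_hitDS => _ [[u uA ->] zu].
  exists ((nbhd_plus A z c u) :\ c).
  have sub : (nbhd_plus A z c u) :\ c \subset nbhd A u.
    by rewrite subDset plus_sub.
  split.
  - split; first by exists (nbhd_plus A z c u) => //; apply: F3.
    by apply: contra zu => /(subsetP sub).
  - by apply: contra (nbhd_notin u bA) => /(subsetP sub).
  - exact: subset_trans sub (subsetUr _ _).
apply: (@needS_play _ b).
apply: (@needD_two_threats _ a z _ _ (([set a; b; c] :\ c) :\ b)
         (([set b; c; z] :\ c) :\ b)).
- by exists ([set a; b; c] :\ c) => //; split=> //; notin_tac.
- subset_tac.
- by exists ([set b; c; z] :\ c) => //; split=> //; notin_tac.
- subset_tac.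
- by rewrite eq_sym.
Qed.


(** * Putting one removed pair back *)

Section Step.
Variables (A : {set G}) (x y z : G).
Hypotheses (xA : x \in A) (yA : y \in A) (zA : z \in A).
Hypotheses (xy : x != y) (edge_xy : x -- y).
Let A' := A :\: [set x; y].
(** What both kinds of removal share. Only inclusions are asked, so that the single edge fits as
    well as a pendant pair whose support has the further neighbour [z]. *)
Hypotheses (nbhd_x : nbhd A x \subset [set x; y])
  (nbhd_y : nbhd A y \subset [set x; y; z])
  (nbhd_rest : forall v, v \in A' -> nbhd A v \subset nbhd_plus A' z y v).

Let inA' v : v \in A' -> [/\ v \in A, v != x & v != y].
Proof. by rewrite !inE negb_or => /andP[/andP[-> ->] ->]. Qed.

Let notinA' a : a \notin A -> a \notin A'.
Proof. by move=> aA; rewrite inE (negPf aA) andbF. Qed.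

Let x_notin v : v \in A' -> x \notin nbhd A v.
Proof.
move=> vA; apply: contraT; rewrite negbK => /(subsetP (nbhd_rest vA)).
apply: contraTT => _; apply: plus_notin => //.
by apply: nbhd_notin; rewrite !inE eqxx.
Qed.

Let y_notin v : v \in A' -> v != z -> y \notin nbhd A v.
Proof.
move=> vA vz; apply: contraT; rewrite negbK => /(subsetP (nbhd_rest vA)).
by rewrite plus_neq // !inE eqxx orbT.
Qed.

Let sub_rest v : v \in A' -> nbhd A v \subset y |: nbhd A' v.
Proof. by move=> vA; apply: subset_trans (nbhd_rest vA) (plus_sub _ _ _ _). Qed.

Let plus_rest z0 a v : v \in A' ->
  nbhd_plus A z0 a v \subset y |: nbhd_plus A' z0 a v.
Proof. by move=> vA; rewrite /nbhd_plus setUA setSU ?sub_rest. Qed.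

Lemma step_S n : needS n (nbhds A') -> needS n.+1 (nbhds A).
Proof.
move=> nA'; apply: (@needS_force _ x y _ _ (nbhd A x)) => //; first by exists x.
apply: needS_covers nA'; apply: covers_hitDS => _ [v vA' ->].
have [vA _ _] := inA' vA'.
by exists (nbhd A v); split; [exists v | exact: x_notin | exact: sub_rest].
Qed.

(** The neighbourhoods of [x] and [y] both contain the pair, and every other one contains its trace
    on [A'], so the pairing strategy applies. *)
Lemma step_win k :
  (winD k (nbhds A') -> winD k.+1 (nbhds A)) /\
  (winS k (nbhds A') -> winS k.+1 (nbhds A)).
Proof.
have xA' : x \notin A' by rewrite !inE eqxx.
have yA' : y \notin A' by rewrite !inE eqxx orbT.
have [|pD pS] := @pairing_win _ k x y (nbhds A') xy.
  by move=> _ [v _ ->]; split; apply: nbhd_notin.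
suff cA : covers (addf [set x; y] (nbhds A')) (nbhds A).
  by split=> [/pD|/pS]; [apply: winD_covers | apply: winS_covers].
move=> _ [v vA ->]; have [vA'|vA'] := boolP (v \in A').
  exists (nbhd A' v); first by right; exists v.
  by apply/subsetP => w; rewrite !inE => /andP[/andP[_ ->]].
exists [set x; y]; first by left.
move: vA'; rewrite inE vA andbT negbK !inE => /orP[]/eqP->.
  by rewrite subUset !sub1set mem_nbhd // !inE yA edge_xy orbT.
by rewrite subUset !sub1set mem_nbhd // !inE xA sedge_sym edge_xy orbT.
Qed.

Variables (n : nat) (LB : lower_bounds A' n).

(** The cases are Dominator's first moves. [y] also dominates [z]; [x] leaves [y] as a new vertex
    joined to [z]; after any other move Staller forces the pair and the D-game bound on [A'] is
    used. *)
Lemma step_D : needD n (nbhds A).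
Proof.
case: n LB => [//|n'] LB'.
apply: (@needD_reply _ _ _ (nbhd A x)) => [|v]; first by exists x.
have [->|vy] := eqVneq v y.
  apply: needS_covers (lb_but LB' z) => _ [v1 [v1A v1z ->]].
  have [vA _ _] := inA' v1A.
  exists (nbhd A v1); first by split; [exists v1 | exact: y_notin].
  by rewrite -(plus_neq A' y v1z) nbhd_rest.
have [->|vx] := eqVneq v x.
  apply: needS_leq (leqnSn _) _.
  have yA' : y \notin A' by rewrite !inE eqxx orbT.
  apply: needS_covers (lb_plus LB' z yA') => _ [v1 v1A ->].
  have [vA _ _] := inA' v1A.
  exists (nbhd A v1); last exact: nbhd_rest.
  by split; [exists v1 | exact: x_notin].
apply: needS_leq (leqSpred n') _.
apply: (@needS_force _ x y _ _ (nbhd A x)) => //.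
  split; first by exists x.
  by apply: contraNN vx => /(subsetP nbhd_x); rewrite !inE (negPf vy) orbF.
apply: needS_covers (@needS_hitD _ _ v _ (lb_D LB')).
apply: covers_hitDS => _ [[v1 v1A ->] vv1].
have [vA _ _] := inA' v1A; exists (nbhd A v1); split.
- split; first by exists v1.
  by apply: contra vv1 => /(subsetP (sub_rest v1A)); rewrite !inE (negPf vy).
- exact: x_notin.
- exact: sub_rest.
Qed.

(** If [x] is the dominated vertex, the pair is itself the attached path of [lb_path2], with [x] in
    the role of the end that need not be dominated. *)
Lemma step_but z0 : needS n (nbhds_but A z0).
Proof.
have [->|z0x] := eqVneq z0 x.
  have xA' : x \notin A' by rewrite !inE eqxx.
  have yA' : y \notin A' by rewrite !inE eqxx orbT.
  apply: needS_covers (lb_path2 LB z xA' yA' xy) => _ [->|[v vA' ->]].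
    by exists (nbhd A y) => //; exists y; rewrite eq_sym.
  have [vA vx _] := inA' vA'.
  by exists (nbhd A v); [exists v | exact: nbhd_rest].
have forced m E : needS m E -> covers (hitD x (hitS y (nbhds_but A z0))) E ->
    needS m.+1 (nbhds_but A z0).
  move=> nE cE; apply: (@needS_force _ x y _ _ (nbhd A x)) => //.
    by exists x; rewrite eq_sym.
  exact: needS_covers nE.
have [z0y|z0y] := eqVneq z0 y.
  apply: needS_leq (leqnSn _) _; apply: forced (lb_S LB) _.
  apply: covers_hitDS => _ [v vA' ->]; have [vA _ vy] := inA' vA'.
  exists (nbhd A v); split; [|exact: x_notin|exact: sub_rest].
  by exists v; rewrite z0y.
apply: needS_leq (leqSpred n) _; apply: forced (lb_but LB z0) _.
apply: covers_hitDS => _ [v [vA' vz0 ->]]; have [vA _ vy] := inA' vA'.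
by exists (nbhd A v); split; [exists v|exact: x_notin|exact: sub_rest].
Qed.

Lemma step_plus z0 a : a \notin A -> needS n.+1 (nbhds_plus A z0 a).
Proof.
move=> aA.
have xA' : x \notin A' by rewrite !inE eqxx.
have yA' : y \notin A' by rewrite !inE eqxx orbT.
have aA' := notinA' aA.
have ax := mem_neq xA aA; have ay := mem_neq yA aA; have az := mem_neq zA aA.
have [->|z0x] := eqVneq z0 x.
  have za : z != a by rewrite eq_sym.
  (* The new vertex at [x] extends the pair to the path [a], [x], [y] attached at [z]. *)
  apply: needS_covers (lb_path3 LB z aA' xA' yA' ax xy ay za) => e.
  case=> [->|[->|[v vA' ->]]].
  - exists (nbhd_plus A x a x); first by exists x.
    rewrite /nbhd_plus eqxx -setUA setUC setUS //.
  - exists (nbhd_plus A x a y); first by exists y.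
    by rewrite plus_neq // eq_sym.
  - have [vA vx _] := inA' vA'; exists (nbhd_plus A x a v); first by exists v.
    by rewrite [nbhd_plus _ x _ _]plus_neq // nbhd_rest.
apply: (@needS_force _ x y _ _ (nbhd_plus A z0 a x)).
- by exists x.
- by rewrite plus_neq // eq_sym.
have [z0y|z0y] := eqVneq z0 y.
  apply: needS_covers (lb_S LB); apply: covers_hitDS => _ [v vA' ->].
  have [vA _ vy] := inA' vA'; exists (nbhd_plus A z0 a v); first split.
  - by exists v.
  - by rewrite plus_neq ?z0y // x_notin.
  - by rewrite plus_neq ?z0y // sub_rest.
apply: needS_covers (lb_plus LB z0 aA'); apply: covers_hitDS => _ [v vA' ->].
have [vA _ vy] := inA' vA'; exists (nbhd_plus A z0 a v); split.
- by exists v.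
- by apply: plus_notin; rewrite 1?eq_sym // x_notin.
- exact: plus_rest.
Qed.

(** For [z0] other than [x], the exchange [y], [x] gives back the same perturbation on [A'], or none
    if [z0] is [y]. For [z0 = x] the path would become too long for the induction, and Staller
    breaks it at [b]. *)
Lemma step_path2 z0 a b : a \notin A -> b \notin A -> a != b ->
  needS n.+1 (addf [set a; b; z0] (nbhds_plus A z0 b)).
Proof.
move=> aA bA ab.
have xA' : x \notin A' by rewrite !inE eqxx.
have yA' : y \notin A' by rewrite !inE eqxx orbT.
have aA' := notinA' aA; have bA' := notinA' bA.
have ax := mem_neq xA aA; have ay := mem_neq yA aA.
have bx := mem_neq xA bA; have neq_by := mem_neq yA bA.
set F := addf _ _.
have Fv v : v \in A -> F (nbhd_plus A z0 b v) by move=> vA; right; exists v.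
have [z0x|z0x] := eqVneq z0 x; last first.
  apply: (@needS_force _ x y _ _ (nbhd_plus A z0 b x)); first exact: Fv.
    by rewrite plus_neq // eq_sym.
  have [z0y|z0y] := eqVneq z0 y.
    apply: needS_covers (lb_S LB); apply: covers_hitDS => _ [v vA' ->].
    have [vA _ vy] := inA' vA'.
    exists (nbhd_plus A z0 b v); split; first exact: Fv.
      by rewrite plus_neq ?z0y // x_notin.
    by rewrite plus_neq ?z0y // sub_rest.
  apply: needS_covers (lb_path2 LB z0 aA' bA' ab).
  apply: covers_hitDS => _ [->|[v vA' ->]].
    exists [set a; b; z0]; split; [by left | by notin_tac | exact: subsetUr].
  have [vA _ vy] := inA' vA'.
  exists (nbhd_plus A z0 b v); split; first exact: Fv.
    by apply: plus_notin; rewrite 1?eq_sym // x_notin.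
  exact: plus_rest.
have Fx : hitS b F ([set a; b; x] :\ b).
  by exists [set a; b; x] => //; left; rewrite z0x.
have Fxy : hitS b F (nbhd_plus A z0 b x :\ b).
  by exists (nbhd_plus A z0 b x) => //; apply: Fv.
have Fxy_sub : nbhd_plus A z0 b x :\ b \subset [set x; y].
  by rewrite subDset; apply: subset_trans (plus_sub _ _ _ _) (setUS _ nbhd_x).
have Frest v : v \in A' -> F (nbhd A v).
  move=> vA'; have [vA vx _] := inA' vA'.
  have vz0 : v != z0 by rewrite z0x.
  by rewrite -(plus_neq A b vz0); apply: Fv.
(* After Staller's b, selecting x would leave two threats {a} and {y}, so
   Dominator must select one of x, y and a. *)
apply: (@needS_play _ b); apply: (needD_reply Fx) => v.
have [->|vx] := eqVneq v x.
  apply: needS_covers (lb_plus LB z yA'); apply: covers_hitDS => _ [u uA' ->].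
  exists (nbhd A u); split; [exact: Frest | exact: x_notin |].
  exact: subset_trans (nbhd_rest uA') (subsetUr _ _).
have [->|vy] := eqVneq v y.
  (* Dominator's [y] also dominates [z]; Staller's [a] forces [x], and this move makes up for the
     loss of one in [lb_but]. *)
  apply: needS_leq (leqSpred n) _.
  apply: (@needS_force _ x a _ _ ([set a; b; x] :\ b)).
  - by split=> //; notin_tac.
  - by subset_tac.
  apply: needS_covers (lb_but LB z); apply: covers_hitDS => _ [u [uA' uz ->]].
  have bu : b \notin nbhd A u by apply: nbhd_notin.
  exists (nbhd A u :\ b); split.
  - split; first by exists (nbhd A u) => //; apply: Frest.
    by rewrite inE negb_and y_notin ?orbT.
  - by rewrite inE negb_and x_notin ?orbT.
  - rewrite -(plus_neq A' y uz); apply: subset_trans (subsetUr _ _).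
    exact: subset_trans (subsetDl _ _) (nbhd_rest uA').
have [->|va] := eqVneq v a.
  apply: needS_leq (leqnSn n) _.
  apply: (@needS_force _ x y _ _ (nbhd_plus A z0 b x :\ b)) => //.
    split=> //; rewrite inE negb_and; apply/orP; right.
    by apply: plus_notin => //; apply: nbhd_notin.
  apply: needS_covers (lb_S LB); apply: covers_hitDS => _ [u uA' ->].
  exists (nbhd A u :\ b); split.
  - split; first by exists (nbhd A u) => //; apply: Frest.
    by rewrite inE negb_and nbhd_notin ?orbT.
  - by rewrite inE negb_and x_notin ?orbT.
  - exact: subset_trans (subsetDl _ _) (sub_rest uA').
apply: (@needS_play _ x).
apply: (@needD_two_threats _ a y _ _ (([set a; b; x] :\ b) :\ x)
         ((nbhd_plus A z0 b x :\ b) :\ x)) => //.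
- by exists ([set a; b; x] :\ b) => //; split=> //; notin_tac.
- by subset_tac.
- exists (nbhd_plus A z0 b x :\ b) => //; split=> //.
  by apply/negP => /(subsetP Fxy_sub); rewrite !inE (negPf vx) (negPf vy).
- by rewrite subDset.
Qed.

Lemma step_path3 z0 a b c : a \notin A -> b \notin A -> c \notin A ->
    a != b -> b != c -> a != c -> z0 != a ->
  needS n.+2 (addf [set a; b; c] (addf [set b; c; z0] (nbhds_plus A z0 c))).
Proof.
move=> aA bA cA ab bc ac za.
have xA' : x \notin A' by rewrite !inE eqxx.
have yA' : y \notin A' by rewrite !inE eqxx orbT.
have aA' := notinA' aA; have bA' := notinA' bA; have cA' := notinA' cA.
have ax := mem_neq xA aA; have ay := mem_neq yA aA.
have bx := mem_neq xA bA; have neq_by := mem_neq yA bA.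
have cx := mem_neq xA cA; have cy := mem_neq yA cA.
set F := addf _ _.
have Fv v : v \in A -> F (nbhd_plus A z0 c v).
  by move=> vA; right; right; exists v.
have [z0x|z0x] := eqVneq z0 x; last first.
  apply: (@needS_force _ x y _ _ (nbhd_plus A z0 c x)); first exact: Fv.
    by rewrite plus_neq // eq_sym.
  have [z0y|z0y] := eqVneq z0 y.
    (* With [z0 = y] already taken by Staller, {b, c} is a second forcing edge; the two exchanges
       give the two extra moves. *)
    apply: (@needS_force _ b c _ _ ([set b; c; z0] :\ y)).
    - split; last by notin_tac.
      by exists [set b; c; z0] => //; right; left.
    - by rewrite z0y; subset_tac.
    apply: needS_covers (lb_S LB); apply: covers_hitDS => _ [v vA' ->].
    have [vA _ vy] := inA' vA'; exists (nbhd A v :\ y); split.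
    - split; last by rewrite inE negb_and x_notin ?orbT.
      have vz0 : v != z0 by rewrite z0y.
      by exists (nbhd A v) => //; rewrite -(plus_neq A c vz0); apply: Fv.
    - by rewrite inE negb_and nbhd_notin ?orbT.
    - rewrite subDset; apply: subset_trans (sub_rest vA') _.
      exact: setUS (subsetUr _ _).
  apply: needS_covers (lb_path3 LB z0 aA' bA' cA' ab bc ac za).
  apply: covers_hitDS => _ [->|[->|[v vA' ->]]].
  - exists [set a; b; c]; split; [by left | by notin_tac | exact: subsetUr].
  - exists [set b; c; z0].
    by split; [right; left | notin_tac | exact: subsetUr].
  have [vA _ vy] := inA' vA'.
  exists (nbhd_plus A z0 c v); split; first exact: Fv.
    by apply: plus_notin; rewrite 1?eq_sym // x_notin.
  exact: plus_rest.
have Fab : hitS c F ([set a; b; c] :\ c).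
  by exists [set a; b; c] => //; left.
have Fbx : hitS c F ([set b; c; x] :\ c).
  by exists [set b; c; x] => //; right; left; rewrite z0x.
have Fxy : hitS c F (nbhd_plus A z0 c x :\ c).
  by exists (nbhd_plus A z0 c x) => //; apply: Fv.
have Fxy_sub : nbhd_plus A z0 c x :\ c \subset [set x; y].
  by rewrite subDset; apply: subset_trans (plus_sub _ _ _ _) (setUS _ nbhd_x).
have Frest v : v \in A' -> F (nbhd A v).
  move=> vA'; have [vA vx _] := inA' vA'.
  have vz0 : v != z0 by rewrite z0x.
  by rewrite -(plus_neq A c vz0); apply: Fv.
(* After Staller's c, the edges {a, b}, {b, x}, {x, y} make b and x the only
   replies of Dominator that leave no double threat. *)
apply: (@needS_play _ c); apply: (needD_reply Fab) => v.
have [->|vb] := eqVneq v b.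
  apply: (@needS_force _ x y _ _ (nbhd_plus A z0 c x :\ c)) => //.
    split=> //; rewrite inE negb_and; apply/orP; right.
    by apply: plus_notin => //; apply: nbhd_notin.
  apply: needS_covers (lb_S LB); apply: covers_hitDS => _ [u uA' ->].
  exists (nbhd A u :\ c); split.
  - split; first by exists (nbhd A u) => //; apply: Frest.
    by rewrite inE negb_and nbhd_notin ?orbT.
  - by rewrite inE negb_and x_notin ?orbT.
  - exact: subset_trans (subsetDl _ _) (sub_rest uA').
have [->|vx] := eqVneq v x.
  apply: (@needS_force _ b a _ _ ([set a; b; c] :\ c)).
  - by split=> //; notin_tac.
  - by subset_tac.
  apply: needS_covers (lb_plus LB z yA'); apply: covers_hitDS => _ [u uA' ->].
  exists (nbhd A u :\ c); split.
  - split; first by exists (nbhd A u) => //; apply: Frest.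
    by rewrite inE negb_and x_notin ?orbT.
  - by rewrite inE negb_and nbhd_notin ?orbT.
  - apply: subset_trans (subsetUr _ _).
    exact: subset_trans (subsetDl _ _) (nbhd_rest uA').
have [->|va] := eqVneq v a.
  apply: (@needS_play _ x).
  apply: (@needD_two_threats _ b y _ _ (([set b; c; x] :\ c) :\ x)
           ((nbhd_plus A z0 c x :\ c) :\ x)) => //.
  - by exists ([set b; c; x] :\ c) => //; split=> //; notin_tac.
  - by subset_tac.
  - exists (nbhd_plus A z0 c x :\ c) => //; split=> //.
    by apply/negP => /(subsetP Fxy_sub); rewrite !inE (negPf ax) (negPf ay).
  - by rewrite subDset.
apply: (@needS_play _ b).
apply: (@needD_two_threats _ a x _ _ (([set a; b; c] :\ c) :\ b)
         (([set b; c; x] :\ c) :\ b)) => //.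
- by exists ([set a; b; c] :\ c) => //; split=> //; notin_tac.
- by subset_tac.
- by exists ([set b; c; x] :\ c) => //; split=> //; notin_tac.
- by subset_tac.
Qed.

Lemma step_lower_bounds : lower_bounds A n.+1.
Proof.
split; [exact: step_S (lb_S LB) | exact: step_D | exact: step_but
  | exact: step_plus | exact: step_path2 | exact: step_path3].
Qed.

End Step.

(* If G[A] is a single edge, y has no neighbour but x, and z := x serves. *)
Lemma nbhd_pendant A x y : pendant_P2 A x y || is_P2 A x y ->
  exists z, [/\ z \in A, nbhd A x \subset [set x; y],
    nbhd A y \subset [set x; y; z] &
    forall v, v \in A :\: [set x; y] ->
      nbhd A v \subset nbhd_plus (A :\: [set x; y]) z y v].
Proof.
case/orP => [/and5P[xA yA xy dx dy]|/andP[/eqP-> xy]]; last first.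
  exists x; split; rewrite ?set21 //.
  - by apply/subsetP => u; rewrite inE => /andP[].
  - by apply/subsetP => u; rewrite inE => /andP[uA _]; rewrite inE uA.
  - by move=> v; rewrite setDv inE.
have yx : y -- x by rewrite sedge_sym.
have xy' : x != y by apply: contraTneq xy => ->; rewrite sedge_irrefl.
have nx u : u \in A -> x -- u -> u = y.
  case/cards1P: dx => w wE uA xu.
  have /set1P-> : u \in [set w] by rewrite -wE inE uA.
  by have /set1P-> : y \in [set w] by rewrite -wE inE yA.
have [z zA ny] : exists2 z, z \in A &
    forall u, u \in A -> y -- u -> u = x \/ u = z.
  case/cards2P: dy => w1 [w2 [_ wE]].
  have wA w : w \in [set w1; w2] -> w \in A by rewrite -wE inE => /andP[].
  have uE u : u \in A -> y -- u -> u = w1 \/ u = w2.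
    by move=> uA yu; apply/set2P; rewrite -wE inE uA.
  case: (uE x xA yx) => xE; [exists w2 | exists w1];
    try by apply: wA; rewrite !inE eqxx ?orbT.
    by rewrite xE.
  by move=> u uA /(uE u uA) []; [right | left; rewrite xE].
exists z; split=> //.
- apply/subsetP => u; rewrite !inE => /andP[uA /orP[->//|/(nx u uA)->]].
  by rewrite eqxx orbT.
- apply/subsetP => u; rewrite !inE => /andP[uA].
  by case/orP => [->|/(ny u uA)[]->]; rewrite ?eqxx ?orbT.
move=> v; rewrite !inE negb_or => /andP[/andP[vx vy] vA].
apply/subsetP => u; rewrite inE => /andP[uA vu].
rewrite 3!inE uA andbT vu andbT !inE.
have [uy|uy] := eqVneq u y.
  rewrite orbT /=; move: vu.
  rewrite uy eq_sym (negPf vy) /= sedge_sym => /(ny v vA).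
  by case=> vE; rewrite vE ?eqxx ?inE ?eqxx // in vx *.
have [ux|//] := eqVneq u x.
move: vu; rewrite ux eq_sym (negPf vx) /= sedge_sym => /(nx v vA) vE.
by rewrite vE eqxx in vy.
Qed.

(** Removals are generated from the whole graph downwards, so each bound is an implication from [A]
    to G, and a further removal is composed in front of it. The S-game bound is carried apart
    because [lower_bounds] is started from a D-game bound. *)
Lemma P2_reduces_bounds A : P2_reduces A -> exists m,
  [/\ #|~: A| = m.*2,
      forall n, lower_bounds A n -> lower_bounds [set: G] (m + n),
      forall n, needS n (nbhds A) -> needS (m + n) (nbhds [set: G]),
      forall k, winD k (nbhds A) -> winD (m + k) (nbhds [set: G]) &
      forall k, winS k (nbhds A) -> winS (m + k) (nbhds [set: G])].
Proof.
elim=> {A} [|A x y _ [m [cA LB nS wD wS]] pA].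
  by exists 0; split=> //; rewrite setCT cards0.
have [xA yA xy] : [/\ x \in A, y \in A & x -- y].
  by case/orP: pA => [/and5P[]//|/andP[/eqP-> ->]]; rewrite set21 set22.
have xy' : x != y by apply: contraTneq xy => ->; rewrite sedge_irrefl.
have [z [zA nx ny nr]] := nbhd_pendant pA.
exists m.+1; split=> [|n|n|k|k].
- rewrite setCD cardsU cA cards2 xy'.
  rewrite (_ : ~: A :&: [set x; y] = set0) ?cards0 ?subn0.
    by rewrite addn2 doubleS.
  apply/setP => w; rewrite !inE; case: eqP => [->|_]; first by rewrite xA.
  by case: eqP => [->|_]; rewrite ?yA ?andbF.
- rewrite addSnnS => LBn; apply: LB.
  exact: (step_lower_bounds xA yA zA xy' nx ny nr).
- by rewrite addSnnS => nn; apply: nS; apply: (step_S xA xy' nx nr).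
- rewrite addSnnS => wk; apply: (wD k.+1).
  by have [wD' _] := step_win xA yA xy' xy k; apply: wD'.
- rewrite addSnnS => wk; apply: (wS k.+1).
  by have [_ wS'] := step_win xA yA xy' xy k; apply: wS'.
Qed.

End PendantRemoval.

(** * Strategies and positions *)

Section Strategies.
Variables (X : sgraph) (first : player) (k : nat).
Implicit Types (p : seq X) (v x : X).

Local Notation Dsel := (dom_selected first).
Local Notation turn := (dom_turn first).
Local Notation N := (nbhd [set: X]).

(* The neighbourhoods that Dominator has not hit yet, without the selected
   vertices. *)
Definition position p : {set X} -> Prop :=
  fun e => exists2 v, N v :&: Dsel p = set0 & e = N v :\: [set x in p].

Definition win_turn i j (E : {set X} -> Prop) :=
  if turn i then winD j E else winS j E.

Lemma turnS i : turn i.+1 = ~~ turn i.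
Proof. by rewrite /dom_turn; case: first. Qed.

Lemma dom_selected_rcons p x : x \notin p ->
  Dsel (rcons p x) = if turn (size p) then x |: Dsel p else Dsel p.
Proof.
move=> xp; apply/setP => v; rewrite !inE mem_rcons inE -cats1 index_cat.
have [->|vx] := eqVneq v x.
  rewrite (negPf xp) /= eqxx addn0.
  by case: ifP => tp; rewrite ?inE ?eqxx // (negPf xp).
by case vp: (v \in p) => /=; case: (turn (size p)); rewrite !inE ?(negPf vx) vp.
Qed.

Lemma dominatingP (D : {set X}) :
  reflect (forall v, N v :&: D != set0) (dominating D).
Proof.
apply: (iffP forallP) => dom v.
  apply/set0Pn; case/orP: (dom v) => [vD|/exists_inP[u uD uv]].
    by exists v; rewrite !inE eqxx.
  by exists u; rewrite !inE sedge_sym uv orbT.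
case/set0Pn: (dom v) => u; rewrite !inE /= => /andP[/orP[/eqP->->//|vu] uD].
by apply/orP; right; apply/exists_inP; exists u; rewrite // sedge_sym.
Qed.

Lemma no_edge_position p : no_edge (position p) <-> dominating (Dsel p).
Proof.
split=> [noE|/dominatingP dom e [v Nv _]]; last by case/eqP: (dom v).
apply/dominatingP => v; apply/eqP => Nv.
by apply: (noE (N v :\: [set x in p])); exists v.
Qed.

Lemma position_rconsS p x : x \notin p -> ~~ turn (size p) ->
  position (rcons p x) = hitS x (position p).
Proof.
move=> xp nt; rewrite /position /hitS dom_selected_rcons // (negPf nt).
have rE v : N v :\: [set y in rcons p x] = (N v :\: [set y in p]) :\ x.
  by apply/setP => w; rewrite !inE mem_rcons inE; case: (w == x).
apply/funext => e; apply/propext; split=> [[v Nv ->]|[_ [v Nv ->] ->]].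
  by exists (N v :\: [set y in p]); rewrite ?rE //; exists v.
by exists v; rewrite ?rE.
Qed.

Lemma position_rconsD p x : x \notin p -> turn (size p) ->
  position (rcons p x) = hitD x (position p).
Proof.
move=> xp t; rewrite /position /hitD dom_selected_rcons // t.
have xN v : (x \in N v :\: [set y in p]) = (x \in N v).
  by rewrite in_setD inE xp.
have rE v : x \notin N v -> N v :\: [set y in p] = N v :\: [set y in rcons p x].
  move: (N v) => B xB; apply/setP => w; rewrite !inE mem_rcons inE.
  by case: eqVneq => // ->; rewrite (negPf xB) !andbF.
apply/funext => e; apply/propext; split=> [[v Nv ->]|[[v Nv ->]]].
  have xNv : x \notin N v.
    apply/negP => xNv; suff : x \in set0 by rewrite inE.
    by rewrite -Nv in_setI xNv setU11.
  split; last by rewrite -rE // in_setD negb_and xNv orbT.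
  exists v; last by rewrite rE.
  by apply/eqP; rewrite -subset0 -Nv setIS // subsetUr.
rewrite xN => xNv; exists v; last by rewrite rE.
by rewrite setIUr Nv setU0; apply/eqP; rewrite setI_eq0 disjoint_sym disjoints1.
Qed.

(** The hitting game lets players repeat vertices; this and the next lemma show that doing so is a
    pass. *)
Lemma played_hitS p v : v \in p -> hitS v (position p) = position p.
Proof.
move=> vp; apply/funext => e; apply/propext.
have E u : (N u :\: [set y in p]) :\ v = N u :\: [set y in p].
  by apply/setDidPl; rewrite disjoint_sym disjoints1 !inE vp.
split=> [[_ [u Nu ->] ->]|[u Nu ->]]; first by exists u; rewrite ?E.
by exists (N u :\: [set y in p]); rewrite ?E //; exists u.
Qed.

Lemma played_hitD p v : v \in p -> hitD v (position p) = position p.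
Proof.
move=> vp; apply/funext => e; apply/propext; split=> [[]//|pe]; split=> //.
by case: pe => u _ ->; rewrite !inE vp.
Qed.

(** * Strategies against won positions *)

Definition reached p := exists j,
  [/\ j <= size p, dominating (Dsel (take j p)) & #|Dsel (take j p)| <= k].

(** The invariant of play: Dominator has already won within [k] moves, or the current position is
    won with the moves he has left. *)
Definition good p := reached p \/
  (#|Dsel p| <= k /\ win_turn (size p) (k - #|Dsel p|) (position p)).

Lemma reached_rcons p x : reached p -> reached (rcons p x).
Proof.
case=> j [jp dj cj]; exists j.
by rewrite size_rcons leqW // -cats1 takel_cat.
Qed.

Lemma reached_now p : dominating (Dsel p) -> #|Dsel p| <= k -> reached p.
Proof. by move=> dp cp; exists (size p); rewrite take_size. Qed.

Lemma reached_rconsP p x : reached (rcons p x) ->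
  reached p \/ (dominating (Dsel (rcons p x)) /\ #|Dsel (rcons p x)| <= k).
Proof.
case=> j [jp dj cj]; move: jp; rewrite size_rcons leq_eqVlt => /orP[/eqP jE|jp].
  by right; move: dj cj; rewrite jE -(size_rcons p x) take_size.
by left; exists j; move: dj cj; rewrite -cats1 takel_cat.
Qed.

Lemma card_dom_rcons p x : x \notin p ->
  #|Dsel (rcons p x)| = turn (size p) + #|Dsel p|.
Proof.
move=> xp; rewrite dom_selected_rcons //; case: ifP => // _.
by rewrite cardsU1 !inE (negPf xp).
Qed.

Lemma exists_free p : size p < #|X| -> exists x, x \notin p.
Proof.
move=> ltp; apply/existsP; rewrite -negb_forall.
apply: contraL ltp => /forallP allp.
rewrite -leqNgt; apply: leq_trans (card_size p).
by apply/subset_leq_card/subsetP => x _; apply: allp.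
Qed.

Lemma follows_rcons sigma p x : follows first sigma p ->
  (turn (size p) -> sigma p = Some x) -> follows first sigma (rcons p x).
Proof.
move=> fp sx i.
rewrite size_rcons ltnS leq_eqVlt onthE map_rcons nth_rcons size_map.
case/predU1P => [->|ip] ti.
  by rewrite ltnn eqxx -cats1 take_size_cat // sx.
by rewrite ip -onthE fp // -cats1 takel_cat // ltnW.
Qed.

(** Backward induction on the number of free vertices: a full play is good by assumption, and
    goodness passes from the continuations that follow [sigma] to the position before them. *)
Lemma good_of_strategy sigma : legal first sigma ->
    (forall p, full_play p -> follows first sigma p ->
      exists j, dominating (Dsel (take j p)) /\ #|Dsel (take j p)| <= k) ->
  forall p, uniq p -> follows first sigma p -> good p.
Proof.
move=> leg win p; move: {2}(#|X| - size p) (erefl (#|X| - size p)) => n.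
elim: n p => [|n IH] p nE up fp.
  have le_p : size p <= #|X| by rewrite -(card_uniqP up) max_card.
  have fullp : size p = #|X| by apply/eqP; rewrite eqn_leq le_p -subn_eq0 nE.
  have [j [dj cj]] := win p (conj up fullp) fp; left.
  have [jp|jp] := leqP j (size p); first by exists j.
  by apply: reached_now; rewrite -[p](@take_oversize _ j) // ltnW.
have ltp : size p < #|X| by rewrite -subn_gt0 nE.
have nEr x : #|X| - size (rcons p x) = n by rewrite size_rcons subnS nE.
have ur x : x \notin p -> uniq (rcons p x) by move=> xp; rewrite rcons_uniq xp.
case: (pselect (reached p)) => rp; [by left | right].
have tr x : turn (size (rcons p x)) = ~~ turn (size p).
  by rewrite size_rcons turnS.
have [tp|tp] := boolP (turn (size p)).
  have [x sx xp] := leg p up ltp tp.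
  have fr : follows first sigma (rcons p x) by apply: follows_rcons.
  have card_r := card_dom_rcons xp; rewrite tp add1n in card_r.
  have posE := position_rconsD xp tp.
  rewrite /win_turn tp.
  case: (IH _ (nEr x) (ur _ xp) fr) => [/reached_rconsP[//|[dom cr]]|[cr]].
    rewrite card_r in cr; split; first exact: ltnW.
    rewrite -(subnSK cr); apply: (@winD_hitD _ _ x); rewrite -posE.
    by apply: no_edge_winS; apply/no_edge_position.
  rewrite /win_turn tr tp /= posE card_r => wS; rewrite card_r in cr.
  by split; [exact: ltnW | rewrite -(subnSK cr); apply: (@winD_hitD _ _ x)].
have gr x : x \notin p ->
    #|Dsel p| <= k /\ winD (k - #|Dsel p|) (hitS x (position p)).
  move=> xp; have fr : follows first sigma (rcons p x).
    by apply: follows_rcons; rewrite ?(negPf tp).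
  have card_r := card_dom_rcons xp; rewrite (negPf tp) add0n in card_r.
  case: (IH _ (nEr x) (ur _ xp) fr) => [/reached_rconsP[//|[dom cr]]|[cr]].
    rewrite dom_selected_rcons // (negPf tp) in dom cr.
    by case: rp; apply: reached_now.
  by rewrite /win_turn tr tp /= position_rconsS // card_r; rewrite card_r in cr.
(* Staller's pass is no better for him than a move on a free vertex, and such a vertex exists since
   the play is not full. *)
have [x0 x0p] := exists_free ltp; have [cp wx0] := gr _ x0p.
have wp : winD (k - #|Dsel p|) (position p).
  exact: winD_covers (@covers_hitS_self _ _ _) wx0.
rewrite /win_turn (negPf tp); split=> //; split=> // u.
have [up'|up'] := boolP (u \in p); first by rewrite played_hitS.
by have [] := gr _ up'.
Qed.

(** The predecessor accounts for the move being made. The fallback to any free vertex keeps the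
    strategy legal in positions that are not won. *)
Definition winning_strategy : strategy X := fun p =>
  if [pick x | (x \notin p) &&
        `[< winS (k - #|Dsel p|).-1 (position (rcons p x)) >]] is Some x
  then Some x else [pick x | x \notin p].

Lemma legal_winning_strategy : legal first winning_strategy.
Proof.
move=> p up /exists_free[x xp] _; rewrite /winning_strategy.
case: pickP => [y /andP[yp _]|_]; first by exists y.
by case: pickP => [y yp|/(_ x)]; [exists y | rewrite xp].
Qed.

Lemma good_rcons p x :
  x \notin p -> (turn (size p) -> winning_strategy p = Some x) ->
  good p -> good (rcons p x).
Proof.
move=> xp sx [rp|[cp wp]]; first by left; apply: reached_rcons.
have tr : turn (size (rcons p x)) = ~~ turn (size p).
  by rewrite size_rcons turnS.
have card_r := card_dom_rcons xp.
have [tp|tp] := boolP (turn (size p)); last first.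
  right; rewrite card_r (negPf tp) add0n; split=> //.
  move: wp; rewrite /win_turn tr tp (negPf tp) /= position_rconsS //.
  by case=> _; apply.
move: wp; rewrite /win_turn tp.
case: (pselect (dominating (Dsel p))) => [dp _|ndp].
  by left; apply: reached_rcons; apply: reached_now.
case kE: (k - #|Dsel p|) => [|k'] /=.
  by case=> // /no_edge_position.
case=> [/no_edge_position//|[v wv]].
right; rewrite /win_turn tr tp card_r tp add1n subnS kE /=.
split; first by rewrite -subn_gt0 kE.
suff [y yp wy] : exists2 y, y \notin p & winS k' (position (rcons p y)).
  have := sx tp; rewrite /winning_strategy kE.
  case: pickP => [z /andP[_ /asboolP wz] [<-//]|/(_ y)].
  by rewrite yp /=; move/asboolP.
(* The winning move of the hitting game may be a vertex selected before, hence a pass; then any free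
   vertex serves at least as well. *)
have [vp|vp] := boolP (v \in p); last by exists v; rewrite // position_rconsD.
exists x => //; rewrite position_rconsD //; rewrite played_hitD // in wv.
exact: winS_covers (@covers_self_hitD _ _ _) wv.
Qed.

(** When every vertex is selected, an unhit neighbourhood would be an empty edge, and such a
    position is not won. *)
Lemma good_full p : full_play p -> good p -> reached p.
Proof.
case=> up sp [//|[cp wp]]; apply: reached_now => //.
apply/no_edge_position => e pe.
have allp : [set x in p] = [set: X].
  by apply/eqP; rewrite eqEcard subsetT cardsT -sp cardsE (card_uniqP up) leqnn.
have e0 : e = set0 by case: pe => v _ ->; rewrite allp setDT.
rewrite e0 in pe; move: wp; rewrite /win_turn.
case: ifP => _; first by move/(lost_winD pe).
by case=> wD _; case: (lost_winD pe wD).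
Qed.

Lemma dom_wins_withinP :
  dom_wins_within X first k <-> win_turn 0 k (nbhds [set: X]).
Proof.
have D0 : Dsel ([::] : seq X) = set0 by apply/setP => v; rewrite !inE.
have pos0 : position [::] = nbhds [set: X].
  rewrite /position D0; apply/funext => e; apply/propext.
  have NE v : N v :\: [set x in [::]] = N v by apply/setP => w; rewrite !inE.
  by split=> [[v _ ->]|[v _ ->]]; exists v; rewrite ?setI0 ?NE ?inE.
have good0 : good [::] <-> win_turn 0 k (nbhds [set: X]).
  rewrite -pos0 /good D0 cards0 subn0; split=> [[[j []]|[]//]|]; last by right.
  move=> /= _ /no_edge_position noE _; rewrite /win_turn.
  by case: ifP => _; [apply: no_edge_winD | apply: no_edge_winS].
rewrite -good0; split=> [[sigma leg win]|g0].
  exact: (good_of_strategy leg win).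
exists winning_strategy; first exact: legal_winning_strategy.
move=> p fp fol; suff /(good_full fp)[j [_ dj cj]] : good p by exists j.
rewrite -[p]take_size; move: (leqnn (size p)); move: {1 3}(size p) => n.
elim: n => [|n IH] ltn; first by rewrite take0.
have x0 : X by case: (p) ltn.
rewrite (take_nth x0) //; apply: good_rcons; last exact/IH/ltnW.
  have [up _] := fp; have := take_uniq n.+1 up.
  by rewrite (take_nth x0) // rcons_uniq => /andP[].
rewrite size_takel ?(ltnW ltn) // => tn; rewrite -(fol n) // onthE.
by rewrite (nth_map x0).
Qed.

End Strategies.

(** * Induced subgraphs and extended values *)

Lemma imfam_nbhds (G : sgraph) (A : {set G}) :
  imfam val (nbhds [set: induced A]) = nbhds A.
Proof.
have valE (v : induced A) : val @: nbhd [set: induced A] v = nbhd A (val v).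
  apply/setP => w; apply/imsetP/idP => [[u + ->]|].
    by rewrite !inE /= => uv; rewrite (valP u).
  rewrite inE => /andP[wA vw]; exists (Sub w wA) => //.
  by rewrite !inE.
apply/funext => e; apply/propext; split=> [[_ [v _ ->] ->]|[v vA ->]].
  by exists (val v); [exact: valP | exact: valE].
exists (nbhd [set: induced A] (Sub v vA)); first by exists (Sub v vA).
by rewrite valE.
Qed.

Lemma dom_wins_induced (G : sgraph) (A : {set G}) first k :
  dom_wins_within (induced A) first k <-> win_turn first 0 k (nbhds A).
Proof.
have c1 : covers (nbhds A) (imfam val (nbhds [set: induced A])).
  by rewrite imfam_nbhds; apply: sub_covers.
have c2 : covers (imfam val (nbhds [set: induced A])) (nbhds A).
  by rewrite imfam_nbhds; apply: sub_covers.
rewrite dom_wins_withinP /win_turn; case: ifP => _; split.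
- exact: winD_imfam val_inj _ _ _ c2.
- exact: winD_of_imfam val_inj _ _ _ c1.
- exact: winS_imfam val_inj _ _ _ c2.
- exact: winS_of_imfam val_inj _ _ _ c1.
Qed.

(** [P] is for the residual graph, [Q] for the whole graph, [m] counts the pairs and [d] is the
    permitted loss. Quantifying over all lower bounds [g] of [P] also handles an infinite
    minimum. *)
Lemma min_or_oo_shift (P Q : nat -> Prop) m d :
    (forall k, P k -> Q (m + k)%N) ->
    (forall g, (forall k, P k -> g <= k) ->
      forall k, Q k -> m + g <= k + d)%N ->
  (m%:R%:E + min_or_oo P - d%:R%:E <= min_or_oo Q)%E /\
  (min_or_oo Q <= m%:R%:E + min_or_oo P)%E.
Proof.
move=> PQ bound; rewrite /min_or_oo.
case: pselect => [exP|nP].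
  case: ex_minnP => p /asboolP Pp minP.
  case: pselect => [exQ|[]]; last by exists (m + p)%N; apply/asboolP/PQ.
  case: ex_minnP => q /asboolP Qq minQ.
  rewrite -!EFinD !lee_fin lerBlDr -!natrD !ler_nat; split.
    by apply: bound Qq => k Pk; apply: minP; apply/asboolP.
  by apply/minQ/asboolP/PQ.
case: pselect => [exQ|_]; last by [].
have [k /asboolP Qk] := exQ.
(* If [P] never holds, every number is a lower bound for it; this one contradicts [Qk]. *)
have : (m + (k + d).+1 <= k + d)%N.
  by apply: bound Qk => j Pj; case: nP; exists j; apply/asboolP.
by rewrite addnC addSn -ltn_subRL subnn.
Qed.

Local Open Scope ereal_scope.

Theorem theorem4p4 (G : sgraph) (A : {set G}) (hA : residual A) :
  let RG := induced A in
  let H := induced (~: A) in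
  let half_nH : \bar rat := (#|H|%:R / 2)%R%:E in
  (gammaMB' G = half_nH + gammaMB' RG)
  /\ (half_nH + gammaMB RG - 1 <= gammaMB G
      /\ gammaMB G <= half_nH + gammaMB RG).
Proof.
case: hA => /P2_reduces_bounds[m [card_H LB nS wD wS]] _ RG H half_nH.
have -> : half_nH = m%:R%:E.
  rewrite /half_nH card_sig (eq_card (B := mem (~: A))) // card_H -muln2 natrM.
  by rewrite mulfK // pnatr_eq0.
split.
  have [||lb ub] := @min_or_oo_shift (dom_wins_within RG Staller)
    (dom_wins_within G Staller) m 0.
  - by move=> k /dom_wins_induced wk; apply/dom_wins_withinP; apply: wS.
  - move=> g gP k /dom_wins_withinP wk; rewrite addn0; apply: nS wk => j wj.
    by apply/gP/dom_wins_induced.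
  (* With [d = 0] the two bounds coincide. *)
  by apply/le_anti; rewrite ub /=; move: lb; rewrite oppe0 adde0.
apply: (@min_or_oo_shift (dom_wins_within RG Dominator)
    (dom_wins_within G Dominator) m 1).
- by move=> k /dom_wins_induced wk; apply/dom_wins_withinP; apply: wD.
- move=> g gP k /dom_wins_withinP wk; rewrite addn1.
  have gR : needD g (nbhds A) by move=> j wj; apply/gP/dom_wins_induced.
  (* The predecessor in [lb_D] is the loss of one in (ii); it is incurred once, after all pairs have
     been put back. *)
  have := lb_D (LB _ (lower_bounds0 gR)) wk.
  by case: (m + g)%N.
Qed.
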